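(* For every natural number $s\ge 3$ there exists a constant $c>0$ such that for all sufficiently large $n$, \[f_{s,s+1}^{(3)}(n)\ \ge\ c\left(\frac{\log n}{\log\log\log n}\right)^{1/3}.\]
   Context: All logarithms are base $2$. $K_t^{(3)}$ denotes the complete $3$-uniform hypergraph on $t$ vertices. For natural numbers $s<t$ and $n$, $f_{s,t}^{(3)}(n)$ is defined as the minimum, over all $3$-uniform hypergraphs $\mathcal{G}$ on $n$ vertices containing no copy of $K_t^{(3)}$, of the maximum size of a vertex set $W\subseteq V(\mathcal{G})$ such that the induced subhypergraph $\mathcal{G}[W]$ contains no copy of $K_s^{(3)}$. *)

(* Defs.v *)
From HB Require Import structures.
From mathcomp Require Import all_boot all_order all_algebra.
From mathcomp Require Import all_classical all_reals all_analysis.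
Set Implicit Arguments.
Unset Strict Implicit.
Unset Printing Implicit Defensive.

(* A hypergraph on the vertex type V is given by its set of edges. *)
Definition hypergraph (V : finType) := {set {set V}}.

Definition uniform (V : finType) (k : nat) (G : hypergraph V) : bool :=
  [forall e in G, #|e| == k].

Definition complete (k t : nat) : hypergraph 'I_t :=
  [set e : {set 'I_t} | #|e| == k].

(* A copy of F in G need not be induced. *)
Definition contains_copy (U V : finType) (F : hypergraph U) (G : hypergraph V)
    : bool :=
  [exists h : {ffun U -> V},
    injectiveb h && [forall e in F, (h @: (e : {set U}))%SET \in G]].

Definition induced (V : finType) (G : hypergraph V) (W : {set V})
    : hypergraph {x : V | x \in W} :=
  [set e : {set {x : V | x \in W}} | [set val x | x in e]%SET \in G].

Definition max_free (s : nat) (V : finType) (G : hypergraph V) : nat :=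
  \max_(W : {set V} | ~~ contains_copy (complete 3 s) (induced G W)) #|W|.

(* The default value n does not affect the minimum when 3 <= t: the empty
   hypergraph is then in the range, and max_free never exceeds n. *)
Definition erdos_rogers (s t n : nat) : nat :=
  \big[minn/n]_(G : hypergraph 'I_n |
      uniform 3 G && ~~ contains_copy (complete 3 t) G) max_free s G.

Definition log2 (R : realType) (x : R) : R := (ln x / ln 2)%R.

(* Main.v *)
(** Idea (following Conlon, Fox and Sudakov). Suppose every K_s^(3)-free vertex
    set has fewer than h elements. Choose vertices v_1, v_2, ... one at a time
    while shrinking a candidate set, so that whether {v_i, v_j, w} is an edge is
    the same for all later vertices and candidates w; this defines a graph on the
    chosen vertices. A K_s in that graph would give a K_(s+1)^(3), and a
    K_(s-1)-free set of the graph is K_s^(3)-free, so neighbourhoods have fewer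
    than h vertices. Hence each step creates fewer than h edges, and keeping an
    edge only when its density is at least 1/(2h) costs a factor h^(O(h)) per
    step. On the other hand a K_s-free graph with m vertices, degrees below h and
    no independent set of size h satisfies m = O(h^2 loglog h / log h), by
    Shearer's argument with a uniformly random independent set. So the process
    cannot run for that many steps, i.e. log n = O(h^3 loglog h). *)

Require Import Defs.
From mathcomp Require Import all_boot.
From mathcomp Require Import zify.
Set Implicit Arguments.
Unset Strict Implicit.
Unset Printing Implicit Defensive.

(** * Independent sets in K_r-free graphs *)

Lemma leq_exp2rW m n e : m <= n -> m ^ e <= n ^ e.
Proof. by case: e => // e; rewrite leq_exp2r. Qed.

(** With [j] the floor of log a, the left side is at most 2^((j+1)q+2). The condition on [k]
    persists up to [j], since its right side doubles at each step. *)
Lemma pow_le_exp2 q k a : k.+1 * q + 2 <= 2 ^ k -> 2 ^ k <= a -> 4 * a ^ q <= 2 ^ a.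
Proof.
move=> hk ka; have a0 : 0 < a by apply: leq_trans ka; rewrite expn_gt0.
have /andP[ja aj] := trunc_log_bounds (isT : 1 < 2) a0.
have kj : k <= trunc_log 2 a.
  by rewrite -ltnS -(ltn_exp2l _ _ (isT : 1 < 2)); apply: leq_ltn_trans ka aj.
move: (trunc_log 2 a) kj ja aj => j kj ja aj.
have {kj hk} hj : j.+1 * q + 2 <= 2 ^ j.
  elim: j kj {ja aj} => [|j IH]; first by rewrite leqn0 => /eqP kE; move: hk; rewrite kE.
  rewrite leq_eqVlt => /predU1P[<- //|]; rewrite ltnS => /IH; rewrite expnS; nia.
apply: leq_trans (_ : 2 ^ (j.+1 * q + 2) <= _); last first.
  by rewrite leq_exp2l //; apply: leq_trans hj ja.
by rewrite expnD mulnC expnM leq_mul // leq_exp2rW // ltnW.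
Qed.

Section Graph.
Variables (T : finType) (F : rel T).
Hypotheses (Fsym : symmetric F) (Firr : irreflexive F).
Implicit Types (X C J N H : {set T}).

Definition clique C := [forall a in C, forall b in C, (a != b) ==> F a b].
Definition indep J := [forall a in J, forall b in J, ~~ F a b].
Definition kfree r X := [forall C : {set T}, (C \subset X) && clique C ==> (#|C| != r)].
Definition nbh X v := [set u in X | F v u].

Lemma cliqueP C :
  reflect (forall a b, a \in C -> b \in C -> a != b -> F a b) (clique C).
Proof.
apply: (iffP forall_inP) => [h a b aC bC ab|h a aC].
  by move/forall_inP: (h a aC) => /(_ b bC) /implyP; apply.
by apply/forall_inP => b bC; apply/implyP => ab; apply: h.
Qed.

Lemma indepP J : reflect (forall a b, a \in J -> b \in J -> F a b = false) (indep J).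
Proof.
apply: (iffP forall_inP) => [h a b aC bC|h a aC].
  by apply/negbTE; move/forall_inP: (h a aC) => /(_ b bC).
by apply/forall_inP => b bC; rewrite h.
Qed.

Lemma kfreeP r X :
  reflect (forall C, C \subset X -> clique C -> #|C| != r) (kfree r X).
Proof.
apply: (iffP forallP) => [h C CX cC|h C].
  by move/implyP: (h C); apply; rewrite CX.
by apply/implyP => /andP[]; apply: h.
Qed.

Lemma indep_sub J H : H \subset J -> indep J -> indep H.
Proof.
by move=> /subsetP s /indepP i; apply/indepP => a b /s aJ /s; apply: i.
Qed.

Lemma kfree_sub r X N : N \subset X -> kfree r X -> kfree r N.
Proof.
by move=> NX /kfreeP k; apply/kfreeP => C CN; apply: k; apply: subset_trans NX.
Qed.

Lemma kfree_nbh r X v : v \in X -> kfree r.+1 X -> kfree r (nbh X v).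
Proof.
move=> vX /kfreeP k; apply/kfreeP => C /subsetP CN cC.
have Nv u : u \in C -> (u \in X) && F v u by move/CN; rewrite inE.
have vC : v \notin C by apply/negP => /Nv; rewrite Firr andbF.
have : #|v |: C| != r.+1.
  apply: k.
    by apply/subsetP => u /setU1P[->|/Nv/andP[]].
  apply/cliqueP => a b /setU1P[->|aC] /setU1P[->|bC]; rewrite ?eqxx //.
  - by case/andP: (Nv _ bC).
  - by case/andP: (Nv _ aC); rewrite Fsym.
  - exact: (cliqueP _ cC).
by rewrite cardsU1 vC add1n eqSS.
Qed.

Lemma indep_kfree r J : 1 < r -> indep J -> kfree r J.
Proof.
move=> r1 /indepP i; apply/kfreeP => C /subsetP CJ /cliqueP c.
apply: contraTneq r1 => <-; rewrite -leqNgt leqNgt.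
apply/negP => /card_gt1P[a [b [aC bC ab]]].
by move: (c _ _ aC bC ab); rewrite i ?CJ.
Qed.

(** Ramsey's argument, by induction on the clique size and then on the independent set. Either a
    neighbourhood, free of the next smaller clique, is large enough, or the non-neighbours of [v]
    are, and [v] extends the independent set found among them. *)
Lemma kfree_indep r a X : kfree r.+1 X -> a ^ r <= #|X| ->
  exists J, [/\ J \subset X, indep J & #|J| = a].
Proof.
elim: r a X => [|r IHr] a X kX.
  rewrite expn0 => /card_gt0P[x xX].
  have /kfreeP/(_ [set x]) := kX; rewrite sub1set xX cards1 eqxx => /(_ isT) h.
  suff /h : clique [set x] by [].
  by apply/cliqueP => u w /set1P-> /set1P->; rewrite eqxx.
elim: a X kX => [|a IHa] X kX hX.
  exists set0; rewrite sub0set cards0; split=> //.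
  by apply/indepP => u w; rewrite inE.
have /card_gt0P[v vX] : 0 < #|X| by apply: leq_trans hX; rewrite expn_gt0.
have kN := kfree_nbh vX kX.
have [hN|hN] := leqP (a.+1 ^ r) #|nbh X v|.
  have [J [JN iJ cJ]] := IHr _ _ kN hN.
  exists J; split=> //; apply: subset_trans JN _.
  by apply/subsetP => u; rewrite inE => /andP[].
pose M := [set u in X :\ v | ~~ F v u].
have cX : #|X| = (#|nbh X v| + #|M|).+1.
  rewrite (cardsD1 v X) vX add1n -(cardsID [set u | F v u] (X :\ v)).
  congr (_ + _).+1; apply: eq_card => u; rewrite !inE.
    by case: eqP => // ->; rewrite Firr !andbF.
  by rewrite andbC.
have MX : M \subset X by apply/subsetP => u; rewrite !inE => /andP[/andP[]].
have hM : a ^ r.+1 <= #|M|.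
  move: hX hN; rewrite cX !expnS => h1 h2.
  have : a ^ r <= a.+1 ^ r by apply: leq_exp2rW.
  move: (a.+1 ^ r) (a ^ r) h1 h2 => A B h1 h2 h3.
  nia.
have [J [JM iJ cJ]] := IHa _ (kfree_sub MX kX) hM.
have vJ u : u \in J -> (u != v) && (F v u == false).
  by move/(subsetP JM); rewrite !inE => /andP[/andP[-> _] /negbTE->].
exists (v |: J); split.
- by rewrite subUset sub1set vX (subset_trans JM).
- apply/indepP => u w /setU1P[->|uJ] /setU1P[->|wJ]; rewrite ?Firr //.
  + by case/andP: (vJ _ wJ) => _ /eqP.
  + by case/andP: (vJ _ uJ) => _ /eqP; rewrite Fsym.
  + exact: (indepP _ iJ).
- rewrite cardsU1 cJ; have -> : v \notin J by apply/negP => /vJ; rewrite eqxx.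
  by [].
Qed.

(** * Sizes of random independent sets *)

(** C(n,i) is at most n^i, and the expansion of (n+1)^t dominates these powers term by term. *)
Lemma card_small_subsets X t :
  #|[set J : {set T} | (J \subset X) && (#|J| < t)]| <= #|X|.+1 ^ t.
Proof.
have -> : #|[set J : {set T} | (J \subset X) && (#|J| < t)]|
   = \sum_(i < t) 'C(#|X|, i).
  rewrite -sum1_card.
  transitivity (\sum_(J : {set T} | (J \subset X) && (#|J| < t))
      \sum_(i < t | i == #|J| :> nat) 1).
    apply: eq_big => [J|J]; rewrite inE // => /andP[_ lt].
    by rewrite (big_pred1 (Ordinal lt)) // => i.
  rewrite (exchange_big_dep predT) //=; apply: eq_bigr => i _.
  rewrite -cards_draws -sum1_card; apply: eq_bigl => J; rewrite !inE.
  case: (J \subset X) => //=; rewrite eq_sym; case: eqP => [->|]; rewrite ?andbF //.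
  by rewrite ltn_ord.
rewrite -add1n expnDn big_ord_recr /= -[leqLHS]addn0 leq_add //.
apply: leq_trans (_ : \sum_(i < t) #|X| ^ i <= _).
  apply: leq_sum => i _.
  apply: leq_trans (_ : 'C(#|X|, i) * i`! <= _); first by rewrite leq_pmulr ?fact_gt0.
  rewrite bin_ffact; elim: (nat_of_ord i) => // j IH.
  by rewrite ffactnSr expnSr leq_mul // leq_subr.
apply: leq_sum => i _; rewrite exp1n mul1n leq_pmull // bin_gt0 ltnW //.
Qed.

Definition indeps X := [set J : {set T} | (J \subset X) && indep J].

(* If a - 1 is the independence number of X, then |X| < a ^ r by Ramsey's bound
   while X has at least 2 ^ (a - 1) independent sets; so the at most (a ^ r) ^ t
   independent sets smaller than t are a minority. *)
Lemma sum_card_indeps r t k X : kfree r.+1 X ->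
    k.+1 * (r * t) + 2 <= 2 ^ k -> 2 * 2 ^ (k * (r * t)) <= #|indeps X| ->
  t * #|indeps X|.+1 <= 4 * \sum_(J in indeps X) #|J|.
Proof.
move=> kX hk hM.
have i0 : set0 \in indeps X.
  by rewrite inE sub0set; apply/indepP => u w; rewrite inE.
have [|J0 J0i J0max] := @eq_bigmax_cond _ (mem (indeps X)) (fun J : {set T} => #|J|).
  by apply/card_gt0P; exists set0.
set a := #|J0|.+1.
have Xa : #|X| < a ^ r.
  rewrite ltnNge; apply/negP => /(kfree_indep kX)[J [JX iJ cJ]].
  have : #|J| <= #|J0|.
    have Ji : J \in indeps X by rewrite inE JX.
    rewrite -J0max.
    exact: (@leq_bigmax_cond _ (fun J => J \in indeps X) (fun J : {set T} => #|J|)).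
  by rewrite cJ ltnn.
have Ma : 2 ^ #|J0| <= #|indeps X|.
  rewrite -card_powerset; apply: subset_leq_card; apply/subsetP => J.
  rewrite !inE in J0i *; case/andP: J0i => J0X iJ0 JJ0.
  by rewrite (subset_trans JJ0 J0X) (indep_sub JJ0).
(* For [a] up to [2 ^ k] the assumed number of independent sets suffices; beyond that, 2^(a-1)
   outgrows the power of [a]. *)
have h2 : 2 * a ^ (r * t) <= #|indeps X|.
  have [ak|ka] := leqP a (2 ^ k).
    by apply: leq_trans hM; rewrite leq_mul2l [2 ^ (k * _)]expnM; apply: leq_exp2rW.
  apply: leq_trans Ma; have := pow_le_exp2 hk (ltnW ka); rewrite /a expnS; lia.
pose small := [set J in indeps X | #|J| < t].
have hB : 2 * #|small| <= #|indeps X|.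
  apply: leq_trans h2; rewrite leq_mul2l /=.
  apply: leq_trans (_ : #|X|.+1 ^ t <= _); last by rewrite expnM; apply: leq_exp2rW.
  apply: leq_trans (card_small_subsets X t); apply: subset_leq_card.
  by apply/subsetP => J; rewrite !inE => /andP[/andP[-> _] ->].
have cM : #|indeps X| = #|small| + #|[set J in indeps X | t <= #|J|]|.
  rewrite -(cardsID [set J : {set T} | #|J| < t] (indeps X)).
  congr (_ + _); apply: eq_card => J.
    by rewrite !inE.
  by rewrite !inE -leqNgt andbC.
have hS : t * #|[set J in indeps X | t <= #|J|]| <= \sum_(J in indeps X) #|J|.
  rewrite mulnC -sum_nat_const [leqRHS](bigID (fun J : {set T} => t <= #|J|)) /=.
  apply: leq_trans (leq_addr _ _).
  by under eq_bigl do rewrite inE; apply: leq_sum => J /andP[].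
(* At least half of the independent sets have size at least [t]; the other factor 2 in the constant
   4 absorbs the successor. *)
have : 0 < #|indeps X| by apply/card_gt0P; exists set0.
move: cM hB hS; nia.
Qed.

Section Fiber.
Variables (X H : {set T}) (v : T).
Let N := nbh X v.
Let Y := [set u in N | [forall w in H, ~~ F u w]].

(** An independent set with trace [H] outside the closed neighbourhood of [v] either contains [v],
    hence nothing of [N], or adds to [H] an independent set of vertices of [N] without neighbours in
    [H]. *)
Lemma fiber_sum (g : {set T} -> nat) : v \in X ->
    H \in [set I :\: (v |: N) | I in indeps X] ->
  \sum_(I in indeps X | I :\: (v |: N) == H) g I =
    g (v |: H) + \sum_(J in indeps Y) g (J :|: H).
Proof.
move=> vX /imsetP[I0 I0i HE].
have [HX iH] : H \subset X /\ indep H.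
  move: I0i; rewrite inE HE => /andP[I0X iI0].
  split; first exact: subset_trans (subsetDl _ _) I0X.
  exact: indep_sub (subsetDl _ _) iI0.
have HN u : u \in H -> (u != v) && (u \notin N).
  by rewrite HE !inE negb_or => /andP[].
have NX u : u \in N -> (u \in X) && F v u by rewrite inE.
have vN : v \notin N by rewrite inE Firr andbF.
rewrite (bigID (fun I : {set T} => v \in I)) /=; congr (_ + _).
  rewrite (big_pred1 (v |: H)) // => I; apply/andP/eqP => [[/andP[Ii /eqP IH] vI]|->].
    apply/setP => u; rewrite -IH !inE; case: (eqVneq u v) => [-> //|uv] /=.
    case uI : (u \in I); rewrite ?andbF // andbT.
    case Fvu: (F v u); rewrite ?andbF //.
    by move: Ii; rewrite inE => /andP[_ /indepP/(_ _ _ vI uI)]; rewrite Fvu.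
  have Fv u : u \in H -> F v u = false.
    move=> uH; have := HN _ uH; rewrite inE (subsetP HX _ uH) /= => /andP[_].
    by move/negbTE.
  split; last by rewrite setU11.
  apply/andP; split.
    rewrite inE subUset sub1set vX HX; apply/indepP => a b.
    move=> /setU1P[->|aH] /setU1P[->|bH]; rewrite ?Firr ?Fv //.
      by rewrite Fsym Fv.
    exact: (indepP _ iH).
  apply/eqP/setP => u; rewrite in_setD !in_setU1 negb_or.
  case uH : (u \in H); last by case: (u == v); rewrite ?andbF.
  by have /andP[/negbTE-> ->] := HN _ uH.
rewrite (reindex_onto (fun J => J :|: H) (fun I => I :&: N)) /=; last first.
  move=> I /andP[/andP[_ /eqP <-] vI]; apply/setP => u.
  rewrite !in_setU in_setI in_setD in_setU1.
  by case: eqP => [->|_]; [rewrite (negbTE vI)|]; case: (u \in I); case: (u \in N).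
apply: eq_bigl => J; apply/idP/idP.
  case/andP => /andP[/andP[]]; rewrite inE => /andP[JHX iJH] _ _ /eqP JN.
  have JI : J \subset J :|: H by apply: subsetUl.
  rewrite inE (indep_sub JI iJH) andbT; apply/subsetP => u uJ; rewrite inE.
  have -> : u \in N by move: uJ; rewrite -JN inE => /andP[].
  apply/forall_inP => w wH; apply/negbT; apply: (indepP _ iJH); first exact: (subsetP JI).
  by rewrite inE wH orbT.
rewrite inE => /andP[JY iJ].
have JN u : u \in J -> u \in N by move/(subsetP JY); rewrite inE => /andP[].
have JH u w : u \in J -> w \in H -> F u w = false.
  by move/(subsetP JY); rewrite inE => /andP[_ /forall_inP h] /h /negbTE.
apply/andP; split; last first.
  apply/eqP/setP => u; rewrite in_setI in_setU.
  case uJ : (u \in J); first by rewrite JN.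
  by case uH : (u \in H) => //=; have /andP[_ /negbTE] := HN _ uH.
rewrite in_setU negb_or; apply/andP; split; last first.
  by apply/andP; split; apply/negP; [move/JN; rewrite (negbTE vN)|move/HN; rewrite eqxx].
apply/andP; split.
  rewrite inE subUset HX andbT; apply/andP; split.
    by apply/subsetP => u /JN /NX/andP[].
  apply/indepP => a b /setUP[aJ|aH] /setUP[bJ|bH].
  - exact: (indepP _ iJ).
  - exact: JH.
  - by rewrite Fsym JH.
  - exact: (indepP _ iH).
apply/eqP/setP => u; rewrite in_setD in_setU1 in_setU negb_or.
case uH : (u \in H); first by rewrite orbT andbT HN.
by rewrite orbF; case uJ : (u \in J); rewrite ?andbF // JN // andbF.
Qed.

End Fiber.

(* The sum is split according to I outside the closed neighbourhood of v. *)
Lemma vertex_weight r t k d X v : v \in X -> kfree r.+1 (nbh X v) ->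
    k.+1 * (r * t) + 2 <= 2 ^ k -> t * 2 ^ (k * (r * t)) <= d ->
  t * #|indeps X| <= 4 * \sum_(I in indeps X) (d * (v \in I) + #|nbh X v :&: I|).
Proof.
move=> vX kN hk hd; rewrite -sum1_card.
pose h (I : {set T}) := I :\: (v |: nbh X v).
rewrite [in leqLHS](partition_big_imset h) [in leqRHS](partition_big_imset h) /=.
rewrite !big_distrr /=; apply: leq_sum => H Hh; rewrite !fiber_sum //.
set N := nbh X v; set Y := [set u in N | _].
have kY : kfree r.+1 Y.
  by apply: kfree_sub kN; apply/subsetP => u; rewrite inE => /andP[].
have sY : \sum_(J in indeps Y) #|J| <=
    \sum_(J in indeps Y) (d * (v \in J :|: H) + #|N :&: (J :|: H)|).
  apply: leq_sum => J; rewrite inE => /andP[JY _].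
  apply: leq_trans (leq_addl _ _); apply: subset_leq_card.
  apply/subsetP => u uJ; rewrite !inE uJ andbT.
  by move/(subsetP JY): uJ; rewrite !inE => /andP[].
rewrite setU11 muln1 sum1_card add1n.
(* If [Y] has many independent sets, their average size is large; if few, the weight [d] of the
   single set [v |: H] pays for the whole fiber. *)
have [le|lt] := leqP (2 * 2 ^ (k * (r * t))) #|indeps Y|.
  by have := sum_card_indeps kY hk le; lia.
have : t * #|indeps Y|.+1 <= 2 * (t * 2 ^ (k * (r * t))).
  by rewrite mulnCA leq_mul2l lt orbT.
lia.
Qed.

(** Double counting: summed over [v], the weights of one independent set [I] give [d] times |I| plus
    the degrees of its vertices, at most 2da. Averaging [vertex_weight] over all [I] gives the
    constant 4 * 2. *)
Lemma indep_bound r t k d a X :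
    (forall v, v \in X -> kfree r.+1 (nbh X v) /\ #|nbh X v| <= d) ->
    (forall J, J \in indeps X -> #|J| <= a) ->
    k.+1 * (r * t) + 2 <= 2 ^ k -> t * 2 ^ (k * (r * t)) <= d ->
  t * #|X| <= 8 * d * a.
Proof.
move=> hX ha hk hd.
have i0 : 0 < #|indeps X|.
  by apply/card_gt0P; exists set0; rewrite inE sub0set; apply/indepP => u w; rewrite inE.
rewrite -(leq_pmul2r i0) mulnAC mulnC -sum_nat_const.
apply: leq_trans (_ : \sum_(v in X) 4 *
    \sum_(I in indeps X) (d * (v \in I) + #|nbh X v :&: I|) <= _).
  by apply: leq_sum => v vX; apply: (vertex_weight vX _ hk hd); case: (hX v vX).
rewrite -big_distrr exchange_big /=.
apply: leq_trans (_ : 4 * \sum_(I in indeps X) (2 * d * a) <= _); last first.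
  by rewrite sum_nat_const (mulnC #|_|) !mulnA.
rewrite leq_mul2l; apply: leq_sum => I Ii; have cI := ha _ Ii.
move: Ii; rewrite inE => /andP[IX _].
have e1 : \sum_(v in X) d * (v \in I) = d * #|I|.
  rewrite -big_distrr /=; congr (_ * _).
  rewrite -sum1_card [LHS](eq_bigr (fun v => if v \in I then 1 else 0)).
    rewrite -big_mkcondr; apply: eq_bigl => v.
    by apply: andb_idl; apply: (subsetP IX).
  by move=> v _; case: (v \in I).
have e2 : \sum_(v in X) #|nbh X v :&: I| <= d * #|I|.
  apply: leq_trans (_ : \sum_(u in I) #|nbh X u| <= _).
    under eq_bigr do rewrite -sum1_card.
    under [leqRHS]eq_bigr do rewrite -sum1_card.
    rewrite (exchange_big_dep (mem I)) /=; last by move=> v u _; rewrite inE => /andP[].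
    apply: leq_sum => u uI; rewrite leq_eqVlt; apply/orP; left; apply/eqP.
    by apply: eq_bigl => v; rewrite !inE uI andbT (subsetP IX _ uI) Fsym.
  rewrite mulnC -sum_nat_const; apply: leq_sum => u uI.
  by case: (hX u (subsetP IX _ uI)).
rewrite big_split /= e1; move: e2 (leq_mul (leqnn d) cI); lia.
Qed.

End Graph.

(** * The link graph of a coherent sequence *)

Section Hypergraph.
Variables (V : finType) (G : hypergraph V).
Implicit Types (C S W E : {set V}) (xs : seq V).

(** Cliques as vertex sets replace the embeddings of [contains_copy]; [hclique_copy] and
    [induced_copy] translate. *)
Definition hclique C := [forall e : {set V}, (e \subset C) && (#|e| == 3) ==> (e \in G)].
Definition hfree s W := [forall C : {set V}, (C \subset W) && hclique C ==> (#|C| != s)].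

Lemma hcliqueP C : reflect
  (forall a b c, a \in C -> b \in C -> c \in C -> a != b -> a != c -> b != c ->
     [set a; b; c] \in G) (hclique C).
Proof.
apply: (iffP forallP) => [h a b c aC bC cC ab ac bc|h e].
  have /implyP := h [set a; b; c]; apply; rewrite !subUset !sub1set aC bC cC /=.
  by rewrite setUC cardsU1 cards2 !inE ab negb_or !(eq_sym c) ac bc.
apply/implyP => /andP[/subsetP eC e3].
have /card_gt0P[c ce] : 0 < #|e| by rewrite (eqP e3).
have : #|e :\ c| == 2 by move: e3; rewrite (cardsD1 c) ce add1n eqSS.
case/cards2P => a [b [ab ecE]].
have eE : e = [set a; b; c] by rewrite -(setD1K ce) ecE setUC.
have /setD1P[ac _] : a \in e :\ c by rewrite ecE !inE eqxx.
have /setD1P[bc _] : b \in e :\ c by rewrite ecE !inE eqxx orbT.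
by rewrite eE; apply: h => //; apply: eC; rewrite eE !inE eqxx ?orbT.
Qed.

Lemma hclique_sub C C' : C' \subset C -> hclique C -> hclique C'.
Proof.
move=> sub /forallP h; apply/forallP => e; apply/implyP => /andP[eC e3].
by apply: (implyP (h e)); rewrite (subset_trans eC sub).
Qed.

Lemma hclique_copy t C : hclique C -> #|C| = t -> contains_copy (complete 3 t) G.
Proof.
move=> /forallP cC Ct; apply/existsP; exists [ffun i => enum_val (cast_ord (esym Ct) i)].
have inj : injective (fun i : 'I_t => enum_val (cast_ord (esym Ct) i)).
  by move=> i j /enum_val_inj /cast_ord_inj.
apply/andP; split; first by apply/injectiveP => i j; rewrite !ffunE => /inj.
apply/forall_inP => e; rewrite inE => e3; apply: (implyP (cC _)).
rewrite (eq_imset _ (ffunE _)) card_imset // e3 andbT.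
by apply/subsetP => _ /imsetP[i _ ->]; apply: enum_valP.
Qed.

Lemma induced_copy t W : contains_copy (complete 3 t) (induced G W) ->
  exists2 C : {set V}, C \subset W & hclique C /\ #|C| = t.
Proof.
case/existsP => h /andP[/injectiveP hinj /forall_inP hG].
pose f i := val (h i); have finj : injective f by move=> i j /val_inj /hinj.
exists [set f i | i : 'I_t].
  by apply/subsetP => _ /imsetP[i _ ->]; apply: valP.
split; last by rewrite card_imset // card_ord.
apply/forallP => e; apply/implyP => /andP[/subsetP eC e3].
have eE : e = f @: (f @^-1: e).
  apply/setP => x; apply/idP/imsetP => [xe|[i]]; last by rewrite inE => ? ->.
  by have /imsetP[i _ xE] := eC _ xe; exists i; rewrite // inE -xE.
have /hG : f @^-1: e \in complete 3 t by rewrite inE -(card_imset _ finj) -eE.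
by rewrite inE -imset_comp [in X in _ -> X]eE.
Qed.

(** The graph on the chosen vertices is realised as the link of any remaining candidate [z]; by
    [coherent_const] the choice of [z] does not matter. *)
Definition link z : rel V := fun a b => [set a; b; z] \in G.

Lemma link_sym z : symmetric (link z).
Proof. by move=> a b; rewrite /link (setUC [set a]). Qed.

Lemma link_irr z : uniform 3 G -> irreflexive (link z).
Proof.
move=> G3 a; apply/negP => /(forall_inP G3); rewrite setUid cards2.
by case: (_ != _).
Qed.

(* [xs] lists the chosen vertices with the latest one first, [S] the
   candidates for later ones. *)
Fixpoint coherent xs S : Prop :=
  if xs is v :: ys then
    [/\ v \notin S, coherent ys (v |: S) &
        forall a w w', a \in ys -> w \in S -> w' \in S -> link w a v = link w' a v]
  else True.

Lemma coherent_sub xs S S' : S' \subset S -> coherent xs S -> coherent xs S'.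
Proof.
elim: xs S S' => //= v xs IH S S' sub [vS cS const]; split.
- by apply: contra vS; apply: (subsetP sub).
- by apply: IH cS; apply: setUS.
- by move=> a w w' axs /(subsetP sub) wS /(subsetP sub); apply: const.
Qed.

Lemma coherent_notin xs S x : coherent xs S -> x \in xs -> x \notin S.
Proof.
elim: xs S => //= v xs IH S [vS cS _]; rewrite inE => /predU1P[-> //|/(IH _ cS)].
by rewrite !inE negb_or => /andP[].
Qed.

Lemma coherent_const xs S a b w w' : coherent xs S -> a \in xs -> b \in xs ->
  a != b -> w \in S -> w' \in S -> link w a b = link w' a b.
Proof.
elim: xs S => //= v xs IH S [vS cS const]; rewrite !inE.
move=> /predU1P[->|axs] /predU1P[->|bxs]; rewrite ?eqxx // => ab wS w'S.
- by rewrite ![link _ v b]link_sym; apply: const.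
- exact: const.
- by apply: (IH _ cS) => //; rewrite !inE ?wS ?w'S orbT.
Qed.

(** Induction on the latest vertex [v]. Both [z] and [v] are candidates for the earlier vertices,
    where their links agree, so each forms a clique with [W :\ v]. The triples containing both [v]
    and [z] come from adjacency to [v] in the link. *)
Lemma link_clique xs S z W : coherent xs S -> z \in S -> {subset W <= xs} ->
  clique (link z) W -> hclique (z |: W).
Proof.
elim: xs S z W => [|v xs IH] S z W.
  move=> _ _ W0 _; apply/hcliqueP => a b c.
  have W_ u : u \in z |: W -> u = z by move=> /setU1P[//|/W0].
  by move=> /W_ -> /W_ ->; rewrite eqxx.
move=> /[dup] coh /= [vS cS const] zS Wxs cW.
pose W' := W :\ v.
have W'xs : {subset W' <= xs}.
  by move=> u; rewrite !inE => /andP[/negbTE uv /Wxs]; rewrite inE uv.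
have cW' : clique (link z) W'.
  by apply/cliqueP => a b /setD1P[_ aW] /setD1P[_ bW]; apply: (cliqueP _ _ cW).
have zvS : z \in v |: S by rewrite inE zS orbT.
have hz := IH _ _ _ cS zvS W'xs cW'.
have [vW|vW] := boolP (v \in W); last first.
  by apply: hclique_sub hz; rewrite setUS // subsetD1 subxx.
have hv : hclique (v |: W').
  apply: (IH _ _ _ cS (setU11 _ _) W'xs); apply/cliqueP => a b aW bW ab.
  rewrite (@coherent_const xs (v |: S) a b v z) ?setU11 ?W'xs //.
  exact: (cliqueP _ _ cW').
rewrite setD1K // in hv.
have zF a : a \in W -> a != v -> [set a; v; z] \in G.
  by move=> aW av; apply: (cliqueP _ _ cW).
apply/hcliqueP => a b c.
have case_ u : u \in z |: W -> [\/ u = z, u = v | u \in W'].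
  rewrite !inE; case: eqP => [->|_]; first by constructor 1.
  case: (eqVneq u v) => [->|uv]; first by constructor 2.
  by move=> /= uW; constructor 3.
have W'W u : u \in W' -> (u \in W) && (u != v) by rewrite !inE andbC.
have inz u : u \in W' -> u \in z |: W' by move=> uW; rewrite inE uW orbT.
have inv u : u \in W' -> u \in W by case/W'W/andP.
have p1 x y t : [set x; y; t] = [set y; x; t] by rewrite (setUC [set x]).
have p2 x y t : [set x; y; t] = [set x; t; y] by rewrite -!setUA (setUC [set y]).
have avz u : u \in W' -> [set u; v; z] \in G by case/W'W/andP; apply: zF.
move=> /case_[->|->|aW] /case_[->|->|bW] /case_[->|->|cW0]; rewrite ?eqxx // => ab ac bc;
  try (by apply: (hcliqueP _ hz); rewrite ?setU11 ?inz);
  try (by apply: (hcliqueP _ hv); rewrite ?vW ?inv).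
- by rewrite p1 p2 p1 avz.
- by rewrite p1 p2 avz.
- by rewrite p2 p1 avz.
- by rewrite p1 avz.
- by rewrite p2 avz.
- exact: avz.
Qed.

(** Take for [c] the latest vertex of [W]: it was a candidate when the others were chosen, so its
    link agrees with that of [z] on them. *)
Lemma hclique_link xs S z W : coherent xs S -> z \in S -> {subset W <= xs} ->
  hclique W -> 0 < #|W| -> exists2 c, c \in W & clique (link z) (W :\ c).
Proof.
elim: xs S => [|v xs IH] S.
  by move=> _ _ W0 _ /card_gt0P[x /W0].
move=> /= [vS cS const] zS Wxs cW W0.
have [vW|vW] := boolP (v \in W).
  exists v => //; apply/cliqueP => a b /setD1P[av aW] /setD1P[bv bW] ab.
  have xs_ u : u \in W -> u != v -> u \in xs.
    by move=> /Wxs; rewrite inE => /predU1P[->|//]; rewrite eqxx.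
  rewrite (@coherent_const xs (v |: S) a b z v) ?xs_ ?inE ?eqxx ?zS ?orbT //.
  exact: (hcliqueP _ cW).
apply: (IH _ cS) => //; first by rewrite inE zS orbT.
by move=> u uW; move: (Wxs _ uW); rewrite inE => /predU1P[uv|//]; rewrite -uv uW in vW.
Qed.

(** For each [a] in turn, keep the candidates forming an edge with [a] and [v] if they make up at
    least 1/(q+1) of the current set, otherwise keep the rest, more than q/(q+1) of it. [E] records
    the edges, [j] counts the non-edges. *)
Lemma split_candidates q v xs S : uniq xs -> exists S' E j,
  [/\ S' \subset S, {subset E <= xs},
      forall a w, a \in xs -> w \in S' -> link w a v = (a \in E),
      #|E| + j = size xs & #|S| * q ^ j <= #|S'| * q.+1 ^ (#|E| + j)].
Proof.
elim: xs => [|a xs IH] /=.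
  by exists S, set0, 0; rewrite cards0 !expn0 !muln1; split=> // x; rewrite inE.
move=> /andP[axs /IH[S1 [E [j [S1S Exs st cE cS]]]]].
have aE : a \notin E by apply/negP => /Exs; rewrite (negbTE axs).
pose Se := [set w in S1 | link w a v].
have SeS : Se \subset S1 by apply/subsetP => w; rewrite inE => /andP[].
have card1 : #|S1| = #|Se| + #|S1 :\: Se|.
  by rewrite -(cardsID Se S1) (setIidPr SeS).
have [le|lt] := leqP #|S1| (q.+1 * #|Se|).
  exists Se, (a |: E), j; split.
  - exact: subset_trans S1S.
  - by move=> u /setU1P[->|/Exs]; rewrite inE ?eqxx // => ->; rewrite orbT.
  - move=> b w; rewrite !inE => /predU1P[->|bxs] /andP[wS wa]; first by rewrite wa eqxx.
    by rewrite st //; case: eqP => // ba; rewrite -ba bxs in axs.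
  - by rewrite cardsU1 aE -cE.
  - rewrite cardsU1 aE -addnA add1n expnS mulnCA; apply: leq_trans cS _.
    by rewrite mulnA leq_mul2r le orbT.
exists (S1 :\: Se), E, j.+1; split.
- exact: subset_trans (subsetDl _ _) S1S.
- by move=> u /Exs uxs; rewrite inE uxs orbT.
- move=> b w; rewrite !inE => /predU1P[->|bxs] /andP[wa wS]; last by rewrite st.
  by move: wa; rewrite wS /= => /negbTE->; apply/esym/negbTE.
- by rewrite addnS cE.
- rewrite addnS !expnS; set P := q.+1 ^ _ in cS *; set p := q ^ j in cS *.
  have : q * #|S1| <= q.+1 * #|S1 :\: Se| by lia.
  move: cS; nia.
Qed.

End Hypergraph.

(** * Building long coherent sequences *)

(** Bernoulli's inequality (1 - 1/(q+1))^i >= 1 - i/(q+1) without denominators; truncated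
    subtraction makes it trivial for i > q. *)
Lemma bernoulli q i : q.+1 ^ i * (q.+1 - i) <= q.+1 * q ^ i.
Proof.
elim: i => [|i IH]; first by rewrite subn0 mul1n muln1.
rewrite !expnS; move: IH; set P := q.+1 ^ i; set p := q ^ i.
have [iq|iq] := ltnP i q; last by rewrite (_ : q.+1 - i.+1 = 0) ?muln0 //; lia.
have [u uE] : exists u, q = i + u.+1 by exists (q - i).-1; lia.
have -> : q.+1 - i = u.+2 by lia.
have -> : q.+1 - i.+1 = u.+1 by lia.
by rewrite uE; nia.
Qed.

(* In disguise: (1 - 1 / (2 h)) ^ i >= 2 ^ - h. *)
Lemma pow_succ_le h i : i <= h ^ 2 -> (2 * h) ^ i <= 2 ^ h * (2 * h).-1 ^ i.
Proof.
case: h => [|h]; first by case: i.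
set q := (2 * h.+1).-1; have -> : 2 * h.+1 = q.+1 by rewrite /q; lia.
(* Bernoulli gives (1 - 1/(q+1))^(h+1) >= 1/2. The power h+1 of this treats the exponent (h+1)^2, to
   which smaller [i] are padded. *)
have hq : q.+1 ^ h.+1 <= 2 * q ^ h.+1.
  have := bernoulli q h.+1; have -> : q.+1 - h.+1 = h.+1 by rewrite /q; lia.
  have -> : q.+1 = 2 * h.+1 by rewrite /q; lia.
  by rewrite [2 * h.+1 * _]mulnAC leq_pmul2r.
move=> ih; have q0 : 0 < q by rewrite /q; lia.
have p0 : 0 < q ^ (h.+1 ^ 2 - i) by rewrite expn_gt0 q0.
rewrite -(leq_pmul2r p0) -mulnA -expnD subnKC //.
apply: leq_trans (_ : q.+1 ^ (h.+1 ^ 2) <= _).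
  by rewrite -{2}(subnKC ih) expnD leq_mul2l leq_exp2rW ?orbT.
rewrite [h.+1 ^ 2]expnS expn1 !expnM -expnMn; exact: leq_exp2rW.
Qed.

Section Erdos_Rogers.
Variables (V : finType) (G : hypergraph V) (r h : nat).
Hypotheses (G3 : uniform 3 G).
Hypothesis G_free : hfree G r.+3 [set: V].
Hypothesis small_free : forall W, hfree G r.+2 W -> #|W| < h.

(** Here [r.+2] is s: a K_s in the link together with [z] would be a forbidden K_(s+1)^(3). *)
Lemma link_kfree xs S z (X : {set V}) : coherent G xs S -> z \in S ->
  {subset X <= xs} -> kfree (link G z) r.+2 X.
Proof.
move=> coh zS Xxs; apply/kfreeP => C /subsetP CX cC.
have Cxs : {subset C <= xs} by move=> u /CX /Xxs.
have hz := link_clique coh zS Cxs cC.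
have zC : z \notin C by apply/negP => /Cxs /(coherent_notin coh); rewrite zS.
have /forallP/(_ (z |: C)) := G_free.
by rewrite subsetT hz cardsU1 zC add1n eqSS.
Qed.

(** A K_s^(3) inside [N] would, less one vertex, be a K_(s-1) of the link. *)
Lemma kfree_small xs S z (N : {set V}) : coherent G xs S -> z \in S -> {subset N <= xs} ->
  kfree (link G z) r.+1 N -> #|N| < h.
Proof.
move=> coh zS Nxs /kfreeP kN; apply: small_free.
apply/forallP => C; apply/implyP => /andP[/subsetP CN cC]; apply/negP => /eqP Cr.
have Cxs : {subset C <= xs} by move=> u /CN /Nxs.
have [|c cC' clC] := hclique_link coh zS Cxs cC; first by rewrite Cr.
have : #|C :\ c| != r.+1.
  by apply: kN clC; apply/subsetP => u /setD1P[_ /CN].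
by move: Cr; rewrite (cardsD1 c) cC' add1n => -[->]; rewrite eqxx.
Qed.

Lemma nbh_small xs S z v : coherent G xs S -> z \in S -> v \in xs ->
  kfree (link G z) r.+1 (nbh (link G z) [set x in xs] v) /\
  #|nbh (link G z) [set x in xs] v| < h.
Proof.
move=> coh zS vxs.
have kN : kfree (link G z) r.+1 (nbh (link G z) [set x in xs] v).
  apply: kfree_nbh; [exact: link_sym|exact: link_irr|by rewrite inE|].
  by apply: link_kfree coh zS _ => u; rewrite inE.
by split=> //; apply: kfree_small coh zS _ kN => u; rewrite !inE => /andP[].
Qed.

(** Each step divides the candidates by at most 2(4h)^h: edges cost (2h)^|E| with |E| < h, non-edges
    2^h in total, and removing [v] a factor 2. *)
Lemma coherent_exists m j : m <= h ^ 2 -> 2 * (2 * (4 * h) ^ h) ^ m <= #|V| ->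
  j <= m -> exists xs S, [/\ coherent G xs S, uniq xs, size xs = j
    & 2 * (2 * (4 * h) ^ h) ^ (m - j) <= #|S|].
Proof.
set D := (4 * h) ^ h => mh hV.
have h0 : 0 < h.
  have : hfree G r.+2 set0.
    apply/forallP => C; apply/implyP => /andP[]; rewrite subset0 => /eqP-> _.
    by rewrite cards0.
  by move/small_free; rewrite cards0.
have D0 : 0 < D by rewrite expn_gt0 muln_gt0 h0.
elim: j => [|j IH] jm; first by exists [::], [set: V]; rewrite subn0 cardsT.
have [xs [S [coh uxs sxs cS]]] := IH (ltnW jm).
have S2 : 1 < #|S| by apply: leq_trans cS; rewrite leq_pmulr // expn_gt0 muln_gt0 D0.
have /card_gt0P[v vS] : 0 < #|S| by apply: ltnW.
(* The parameter 2h - 1 sets the density threshold at 1/(2h). *)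
have [S' [E [i [S'S Exs st cE cS']]]] :=
  split_candidates G (2 * h).-1 v (S :\ v) uxs.
have SvE : #|S| = #|S :\ v|.+1 by rewrite (cardsD1 v S) vS.
have q0 : 0 < (2 * h).-1 ^ i by rewrite expn_gt0; apply/orP; left; lia.
rewrite prednK in cS'; last by rewrite muln_gt0.
have /card_gt0P[z zS'] : 0 < #|S'|.
  by case: #|S'| cS' => // ; rewrite mul0n leqn0 muln_eq0; lia.
have vxs : v \notin xs by apply: contraTN vS; apply: coherent_notin coh.
have coh' : coherent G (v :: xs) S'.
  split.
  - by apply/negP => /(subsetP S'S); rewrite !inE eqxx.
  - apply: coherent_sub coh; rewrite subUset sub1set vS /=.
    exact: subset_trans S'S (subD1set _ _).
  - by move=> a w w' axs wS w'S; rewrite !st.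
(* The bound on [E] comes after the split: in the link of a surviving [z], the set [E] lies in the
   neighbourhood of [v]. *)
have Eh : #|E| < h.
  apply: leq_ltn_trans (proj2 (nbh_small coh' zS' (mem_head _ _))).
  apply: subset_leq_card; apply/subsetP => a aE; rewrite !inE.
  by rewrite Exs // orbT (link_sym _ _ v) (st _ _ (Exs _ aE)).
exists (v :: xs), S'; split=> //=; [by rewrite vxs| by rewrite sxs|].
have hi : (2 * h) ^ i <= 2 ^ h * (2 * h).-1 ^ i.
  by apply: pow_succ_le; apply: leq_trans mh; lia.
have hD : (2 * h) ^ #|E| * 2 ^ h <= D.
  rewrite /D (_ : 4 * h = (2 * h) * 2); last by lia.
  by rewrite [leqRHS]expnMn leq_mul2r leq_pexp2l ?orbT ?muln_gt0 // ltnW.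
have {cS'} cS' : #|S :\ v| <= #|S'| * D.
  rewrite -(leq_pmul2r q0); apply: leq_trans cS' _.
  rewrite expnD -!mulnA leq_mul2l; apply/orP; right.
  apply: leq_trans (leq_mul (leqnn _) hi) _.
  by rewrite mulnA leq_mul2r hD orbT.
have jE : m - j = (m - j.+1).+1 by lia.
move: cS; rewrite jE expnS mulnCA -mulnA; set P := 2 * _ => cS.
have D2 : 0 < 2 * D by rewrite muln_gt0.
rewrite -(leq_pmul2l D2) -mulnA; apply: leq_trans cS _; lia.
Qed.

(** [indep_bound] for the link of a last candidate, with [h] bounding both degrees and independent
    sets; the latter are K_(s-1)-free because [0 < r]. *)
Lemma no_large_order k t m : 0 < r -> k.+1 * (r * t) + 2 <= 2 ^ k ->
  t * 2 ^ (k * (r * t)) <= h -> m <= h ^ 2 ->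
  2 * (2 * (4 * h) ^ h) ^ m <= #|V| -> t * m <= 8 * h ^ 2.
Proof.
move=> r0 hk ht mh hV.
have [xs [S [coh uxs sxs cS]]] := coherent_exists mh hV (leqnn m).
have /card_gt0P[z zS] : 0 < #|S| by move: cS; rewrite subnn expn0; lia.
have mE : m = #|[set x in xs]| by rewrite cardsE (card_uniqP uxs).
rewrite mE -mulnn mulnA.
apply: (@indep_bound _ (link G z) _ _ r t k) => //.
- exact: link_sym.
- exact: link_irr.
- move=> v; rewrite inE => vxs; have [kN /ltnW] := nbh_small coh zS vxs.
  by split.
- move=> J; rewrite inE => /andP[JX iJ]; apply: ltnW.
  apply: (kfree_small coh zS) => [u /(subsetP JX)|]; first by rewrite inE.
  exact: indep_kfree.
Qed.

End Erdos_Rogers.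

(** * Choice of parameters *)

(** The bound [h <= n] takes care of the default value of the minimum. *)
Lemma erdos_rogers_ge s n h : h <= n ->
  (forall G : hypergraph 'I_n, uniform 3 G -> hfree G s.+1 [set: 'I_n] ->
     exists2 W, hfree G s W & h <= #|W|) ->
  h <= erdos_rogers s s.+1 n.
Proof.
move=> hn hG; rewrite /erdos_rogers.
apply: (big_ind (fun x => h <= x)) => // [x y hx hy|G /andP[G3 Gf]].
  by rewrite leq_min hx hy.
have [|W /forallP Wf hW] := hG G G3.
  apply/forallP => C; apply/implyP => /andP[_ cC]; apply: contra Gf => /eqP.
  exact: hclique_copy.
apply: leq_trans hW _; apply: (bigmax_sup W) => //.
apply/negP => /induced_copy[C CW [cC Cs]].
by have := Wf C; rewrite CW cC Cs eqxx.
Qed.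

Lemma sqr_le_exp2 j : 6 <= j -> j.+1 ^ 2 <= 2 ^ j.
Proof.
elim: j => // j IH; rewrite leq_eqVlt => /predU1P[<- //|].
by rewrite ltnS => /[dup] j6 /IH; rewrite -!mulnn [2 ^ j.+1]expnS; nia.
Qed.

(** With [l] about log h and [k] about loglog h, [t] is about l/(4kr) and [m] is the least integer
    with mt > 8h^2. If all K_s^(3)-free sets were smaller than [h], this would contradict
    [no_large_order]. *)
Lemma erdos_rogers_lower r h n : 0 < r -> 2 ^ 2 ^ (64 * r) <= h ->
  2 ^ (145 * r * (trunc_log 2 (trunc_log 2 h)).+1 * h ^ 3) <= n ->
  h <= erdos_rogers r.+2 r.+3 n.
Proof.
move=> r0 hh.
have h0 : 0 < h by apply: leq_trans hh; rewrite expn_gt0.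
have /andP[lh hl] := trunc_log_bounds (isT : 1 < 2) h0.
set l := trunc_log 2 h in lh hl *.
have jl : 2 ^ (64 * r) <= l.
  by rewrite -ltnS -(ltn_exp2l _ _ (isT : 1 < 2)); apply: leq_ltn_trans hh hl.
have l0 : 0 < l by apply: leq_trans jl; rewrite expn_gt0.
have /andP[jl2 lj] := trunc_log_bounds (isT : 1 < 2) l0.
set j := trunc_log 2 l in jl2 lj *.
have rj : 64 * r <= j.
  by rewrite -ltnS -(ltn_exp2l _ _ (isT : 1 < 2)); apply: leq_ltn_trans jl lj.
set k := j.+1 in lj *.
have kl : k ^ 2 <= l by apply: leq_trans jl2; apply: sqr_le_exp2; lia.
have ll : l < h by apply: leq_trans lh; apply: ltn_expl.
set t := l %/ (4 * k * r); set m := ((8 * h ^ 2) %/ t).+1.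
have tl : t * (4 * k * r) <= l by apply: leq_trunc_div.
have lt : l < t.+1 * (4 * k * r) by apply: ltn_ceil; rewrite !muln_gt0 r0.
(* Here 64 is used: l >= k^2 and k > 64r give l/(4kr) >= 16. *)
have t16 : 16 <= t.
  rewrite leq_divRL ?muln_gt0 ?r0 //; apply: leq_trans kl.
  by rewrite -mulnn /k; nia.
have t0 : 0 < t by apply: leq_trans t16.
have mt1 : 8 * h ^ 2 < m * t by apply: ltn_ceil.
have mt2 : m * t <= 8 * h ^ 2 + t by rewrite /m mulSn (addnC t) leq_add2r leq_trunc_div.
have th : t <= h.
  by apply: leq_trans (ltnW ll); apply: leq_div.
clearbody t m l j => {hh}.
have k0 : 0 < k by [].
clearbody k.
have c1 : k.+1 * (r * t) + 2 <= 2 ^ k.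
  apply: leq_trans lj; have : t * (4 * k * r) = 4 * (k * (r * t)) by lia.
  have : 0 < r * t by rewrite muln_gt0 r0.
  move: (r * t) tl => u; nia.
have c2 : t * 2 ^ (k * (r * t)) <= h.
  apply: leq_trans lh; apply: leq_trans (_ : 2 ^ (k * (r * t)) * 2 ^ (k * (r * t)) <= _).
    rewrite leq_mul2r; apply/orP; right.
    apply: leq_trans (ltnW (ltn_expl t (isT : 1 < 2))) _.
    by rewrite leq_exp2l // mulnA leq_pmull // muln_gt0 k0.
  by rewrite -expnD leq_exp2l //; lia.
have c3 : m <= h ^ 2.
  rewrite leqNgt; apply/negP => mh; have h2 : 0 < h ^ 2 by rewrite expn_gt0 h0.
  move: (h ^ 2) mh mt2 h2 => H; nia.
(* The exponent is at most 1 + 144rkh^3, where 144 = 2 * 8 * 9 collects the factors of [e1], [e2]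
   and [e3]. *)
have c4 : 2 * (2 * (4 * h) ^ h) ^ m <= 2 ^ (145 * r * k * h ^ 3).
  apply: leq_trans (_ : 2 * (2 * (2 ^ (l + 3)) ^ h) ^ m <= _).
    rewrite leq_mul2l /=; apply: leq_exp2rW; rewrite leq_mul2l /=; apply: leq_exp2rW.
    by move: hl; rewrite expnD expnS; lia.
  rewrite -expnM -expnS -expnM -expnS leq_exp2l //.
  have e1 : ((l + 3) * h).+1 <= 2 * l * h by nia.
  have e2 : l <= 8 * (k * r) * t by nia.
  have e3 : m * t <= 9 * h ^ 2 by rewrite -mulnn in mt2 *; nia.
  have e4 : ((l + 3) * h).+1 * m <= 144 * (r * k * h ^ 3).
    apply: leq_trans (leq_mul e1 (leqnn m)) _.
    apply: leq_trans (_ : 2 * (8 * (k * r) * t) * h * m <= _).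
      by rewrite !leq_mul.
    apply: leq_trans (_ : 16 * (k * r) * h * (9 * h ^ 2) <= _).
      apply: leq_trans (_ : 16 * (k * r) * h * (m * t) <= _); last by rewrite leq_mul.
      lia.
    rewrite expnS; lia.
  have : 0 < r * k * h ^ 3 by rewrite !muln_gt0 r0 k0 h0.
  rewrite (_ : 145 * r * k * h ^ 3 = 145 * (r * k * h ^ 3)); first by move: e4; lia.
  by rewrite !mulnA.
move=> hn; have {c4} hn := leq_trans c4 hn.
have hm : h <= n.
  apply: leq_trans hn.
  have m0 : 0 < m by case: (m) mt1.
  have le_exp x e : 0 < e -> x <= x ^ e.
    by case: e => // e _; case: x => // x; rewrite expnS leq_pmulr ?expn_gt0.
  apply: leq_trans (_ : 4 * h <= _); first by rewrite leq_pmull.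
  apply: leq_trans (le_exp _ _ h0) _; apply: leq_trans (leq_pmull _ (isT : 0 < 2)) _.
  by apply: leq_trans (le_exp _ _ m0) _; rewrite leq_pmull.
apply: erdos_rogers_ge => // G G3 Gf.
have [/existsP[W /andP[]]|] :=
  boolP [exists W : {set 'I_n}, hfree G r.+2 W && (h <= #|W|)].
  by exists W.
rewrite negb_exists => /forallP small.
have sf W : hfree G r.+2 W -> #|W| < h.
  by move=> Wf; rewrite ltnNge; have := small W; rewrite Wf.
have := no_large_order G3 Gf sf r0 c1 c2 c3; rewrite card_ord => /(_ hn).
by rewrite leqNgt [t * m]mulnC mt1.
Qed.

(** * Asymptotics *)

From mathcomp Require Import all_boot all_order all_algebra.
From mathcomp Require Import all_classical all_reals all_analysis.
From mathcomp Require Import lra.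
Import Order.TTheory GRing.Theory Num.Theory.
Local Open Scope ring_scope.

Section Log2.
Variable R : realType.
Implicit Types x y : R.

Lemma ln2_gt0 : 0 < ln 2 :> R.
Proof. by apply: ln_gt0; rewrite ltr1n. Qed.

Lemma log2_exp k : log2 (2 ^+ k : R) = k%:R.
Proof. by rewrite /log2 lnXn ?ltr0n // mulrnAl divff // gt_eqF // ln2_gt0. Qed.

Lemma ler_log2 x y : 0 < x -> x <= y -> log2 x <= log2 y.
Proof.
move=> x0 xy; rewrite /log2 ler_pM2r ?invr_gt0 ?ln2_gt0 //.
by rewrite ler_ln // posrE // (lt_le_trans x0).
Qed.

Lemma le_log2 k x : 2 ^+ k <= x -> k%:R <= log2 x.
Proof. by move=> /ler_log2; rewrite log2_exp; apply; rewrite exprn_gt0. Qed.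

Lemma trunc_log_log2 k x : k%:R <= x -> 1 <= x -> (trunc_log 2 k)%:R <= log2 x.
Proof.
move=> kx x1; case: k kx => [|k] kx.
  by rewrite trunc_log0; apply: le_log2; rewrite expr0.
apply: le_log2; apply: le_trans kx; rewrite -natrX ler_nat.
by have /andP[] := trunc_log_bounds (isT : (1 < 2)%N) (ltn0Sn k).
Qed.

End Log2.

Theorem theorem5p2 (R : realType) (s : nat) (hs : (3 <= s)%N) :
  exists c : R, 0 < c /\
    exists n0 : nat, forall n : nat, (n0 <= n)%N ->
      c * (log2 (n%:R : R) / log2 (log2 (log2 (n%:R : R)))) `^ (3%:R^-1)
        <= (erdos_rogers s s.+1 n)%:R.
Proof.
case: s hs => [|[|[|r']]] // _; set r := r'.+1.
(* The factor 16 is 2 * 8: passing from [K.+1] to 2u, and from (M+1)^3 to 8M^3. *)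
pose D := (16 * (145 * r))%N.
have D0 : 0 < D%:R :> R by rewrite ltr0n.
exists D%:R^-1; split; first by rewrite invr_gt0.
pose h0 := (2 ^ 2 ^ (64 * r))%N.
(* The first bound makes logloglog n at least 1, the second makes [M] at least [h0]. *)
exists (maxn (2 ^ 2 ^ 2 ^ 1)
  (2 ^ (145 * r * (trunc_log 2 (trunc_log 2 h0)).+1 * h0 ^ 3))) => n.
rewrite geq_max => /andP[n16 nh0].
set M := erdos_rogers _ _ _.
have Mh0 : (h0 <= M)%N by apply: erdos_rogers_lower nh0.
have M0 : (0 < M)%N by apply: leq_trans Mh0; rewrite expn_gt0.
(* Otherwise the lower bound at [M.+1] would exceed the value [M] itself. *)
have nM : (n < 2 ^ (145 * r * (trunc_log 2 (trunc_log 2 M.+1)).+1 * M.+1 ^ 3))%N.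
  rewrite ltnNge; apply/negP => /(@erdos_rogers_lower r M.+1 n isT (leqW Mh0)).
  by rewrite ltnn.
set L := log2 n%:R; set u := log2 (log2 L).
have n0 : 0 < n%:R :> R by rewrite ltr0n; apply: leq_trans n16; rewrite expn_gt0.
have L4 : (2 ^ 2 ^ 1)%:R <= L by rewrite /L; apply: le_log2; rewrite -natrX ler_nat.
have L2 : (2 ^ 1)%:R <= log2 L by apply: le_log2; rewrite -natrX.
have u1 : 1 <= u by rewrite /u; apply: (@le_log2 _ 1).
have u0 : 0 < u by apply: lt_le_trans u1.
have LM : L <= (145 * r * (trunc_log 2 (trunc_log 2 M.+1)).+1 * M.+1 ^ 3)%:R.
  by rewrite -log2_exp -natrX; apply: ler_log2; rewrite // ler_nat ltnW.
have M1 : 1 <= M%:R :> R by rewrite ler1n.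
have key : L / u <= D%:R * M%:R ^+ 3.
  rewrite ler_pdivrMr //.
  (* If M + 1 <= log n, then loglog(M+1) is at most [u]; otherwise [M] already exceeds log n - 1 and
     a crude estimate suffices. *)
  have [ML|LM'] := leP M.+1%:R L.
    set K := trunc_log 2 _ in LM.
    have Ku : K%:R <= u.
      apply: trunc_log_log2; last by apply: le_trans L2; rewrite ler1n.
      by apply: trunc_log_log2 => //; apply: le_trans L4; rewrite ler1n.
    apply: le_trans LM _.
    have MM : M.+1%:R ^+ 3 <= 8 * M%:R ^+ 3 :> R.
      rewrite (_ : 8 = 2 ^+ 3); last by rewrite -natrX.
      by rewrite -exprMn lerXn2r ?nnegrE ?mulr_ge0 //; lra.
    rewrite natrM natrX natrM.
    apply: le_trans (_ : (145 * r)%:R * (2 * u) * (8 * M%:R ^+ 3) <= _).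
      apply: ler_pM; rewrite ?mulr_ge0 ?exprn_ge0 //.
      rewrite ler_wpM2l // -natr1; lra.
    by rewrite /D natrM; lra.
  have M3 : M%:R <= M%:R ^+ 3 :> R by rewrite exprS ler_peMr ?exprn_ege1 //; lra.
  have : 16 <= D%:R :> R by rewrite ler_nat leq_pmulr.
  move=> /(ler_wpM2r (exprn_ge0 3 (ler0n R M))) D16.
  apply: le_trans (_ : D%:R * M%:R ^+ 3 <= _); last first.
    by rewrite ler_peMr ?mulr_ge0 ?exprn_ge0.
  by move: LM'; rewrite -natr1; lra.
rewrite ler_pdivrMl //.
have -> : D%:R * M%:R = ((D%:R * M%:R) ^+ 3) `^ 3%:R^-1 :> R.
  by rewrite -powR_mulrn ?mulr_ge0 // -powRrM divff ?powRr1 ?mulr_ge0.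
have Lu0 : 0 <= L / u by rewrite divr_ge0 ?(ltW u0) // (le_trans _ L4).
apply: ge0_ler_powR; rewrite ?nnegrE ?Lu0 ?invr_ge0 ?exprn_ge0 ?mulr_ge0 //.
(* The constant 1/D instead of its cube root is affordable, as D <= D^3. *)
apply: le_trans key _; rewrite exprMn ler_wpM2r ?exprn_ge0 //.
by rewrite exprS ler_peMr ?exprn_ege1 ?ler1n // ltW.
Qed.
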